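(* Let $k$ be a subfield of $\mathbf{C}$ and let $A$ be a locally finite graded set with an operation $[\cdot,\cdot]$ on $\bar A=A\cup\{0\}$ satisfying (S0)–(S3). For generic $q\in k$, the map $\Phi_q$ is a Hopf algebra isomorphism from $(\mathfrak{A},\mathrm{conc},\delta)$ to $(\mathfrak{A},*_q,\Delta_q)$.
   Context: $A$ is a graded set, $A=\bigsqcup_{n\ge1}A_n$ with each $A_n$ (the elements of degree $n$) finite; elements of $A$ are called letters and $|a|$ is the degree of a letter $a$. $\mathfrak{A}=k\langle A\rangle$ is the $k$-vector space of noncommutative polynomials in the letters, with basis the words (monomials) in the letters, including the empty word $1$; juxtaposition (also written $\mathrm{conc}$) denotes the concatenation product. The degree $|w|$ of a word $w$ is the sum of the degrees of its letters. Let $\bar A=A\cup\{0\}$ and let $[\cdot,\cdot]:\bar A\times\bar A\to\bar A$ be a function satisfying: (S0) $[a,0]=0$ for all $a\in\bar A$; (S1) $[a,b]=[b,a]$ for all $a,b\in\bar A$; (S2) $[[a,b],c]=[a,[b,c]]$ for all $a,b,c\in\bar A$; (S3) for all $a,b\in A$, either $[a,b]=0$ or $|[a,b]|=|a|+|b|$. For $q\in k$, the product $*_q$ is the $k$-bilinear (associative) operation on $\mathfrak{A}$ defined recursively on words by $1*_qw=w*_q1=w$ and $aw_1*_qbw_2=a(w_1*_qbw_2)+q^{|aw_1||b|}\,b(aw_1*_qw_2)+q^{|w_1||b|}\,[a,b](w_1*_qw_2)$ for letters $a,b$ and words $w_1,w_2$ (with $q^0=1$, also for $q=0$). $\Phi_q:(\mathfrak{A},\mathrm{conc})\to(\mathfrak{A},*_q)$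 is the homomorphism of graded associative $k$-algebras with $\Phi_q(a_1\cdots a_n)=a_1*_q\cdots*_qa_n$ for letters $a_1,\dots,a_n$. The element $q$ is called generic if $\Phi_q$ is an isomorphism. For generic $q$, $\Delta_q:\mathfrak{A}\to\mathfrak{A}\otimes\mathfrak{A}$ is the comultiplication determined by $\Delta_q(a)=a\otimes1+1\otimes a$ for all $a\in A$ and $\Delta_q(u*_qv)=\Delta_q(u)*_q\Delta_q(v)$ for all $u,v\in\mathfrak{A}$, where $(x\otimes y)*_q(x'\otimes y')=(x*_qx')\otimes(y*_qy')$; this makes $(\mathfrak{A},*_q,\Delta_q)$ a Hopf algebra. $(\mathfrak{A},\mathrm{conc},\delta)$ is the concatenation Hopf algebra, with $\delta(w)=\sum_{u,v}(u\,ш\,v,w^* )\,u\otimes v$ (sum over all words $u,v$), where $(x,w^* )$ denotes the coefficient of the word $w$ in $x\in\mathfrak{A}$ and the shuffle product $ш$ is the bilinear operation given by $1\,ш\,w=w\,ш\,1=w$ and $aw_1\,ш\,bw_2=a(w_1\,ш\,bw_2)+b(aw_1\,ш\,w_2)$. *)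

(* Defs.v *)
From HB Require Import structures.
From mathcomp Require Import all_boot all_order all_algebra.
From mathcomp Require Import finmap complex.
From mathcomp Require Import boolp classical_sets functions cardinality.
From mathcomp Require Import fsbigop reals.
From mathcomp.multinomials Require Import monalg.

Set Implicit Arguments.
Unset Strict Implicit.
Unset Printing Implicit Defensive.

Import GRing.Theory.

Local Open Scope ring_scope.

(* {malg k[K]} is the free k-module on K, with basis elements << x >> for
   x : K.  The tensor product of the free modules on K and L is taken to be
   the free module on K * L, the basis element << (x, y) >> being
   << x >> (x) << y >>. *)
Section FreeModules.
Variable k : fieldType.

Definition lin_ext (K : choiceType) (U : lmodType k) (f : K -> U)
    (x : {malg k[K]}) : U :=
  \sum_(i <- msupp x) x@_i *: f i.

Definition bilin_ext (K L : choiceType) (U : lmodType k) (f : K -> L -> U)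
    (x : {malg k[K]}) (y : {malg k[L]}) : U :=
  lin_ext (fun i => lin_ext (f i) y) x.

Definition tens (K L : choiceType) (x : {malg k[K]}) (y : {malg k[L]}) :
    {malg k[(K * L)%type]} :=
  bilin_ext (fun i j => << (i, j) >>) x y.

Definition tens_map (K L K' L' : choiceType)
    (f : {malg k[K]} -> {malg k[K']}) (g : {malg k[L]} -> {malg k[L']})
    (z : {malg k[(K * L)%type]}) : {malg k[(K' * L')%type]} :=
  lin_ext (fun p => tens (f << p.1 >>) (g << p.2 >>)) z.

Definition tens_assoc (K L M : choiceType)
    (z : {malg k[((K * L) * M)%type]}) : {malg k[(K * (L * M))%type]} :=
  lin_ext (fun p => << (p.1.1, (p.1.2, p.2)) >>) z.

(* (x (x) y) (x' (x) y') = m x x' (x) m y y' *)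
Definition tens_mul (K : choiceType)
    (m : {malg k[K]} -> {malg k[K]} -> {malg k[K]})
    (z z' : {malg k[(K * K)%type]}) : {malg k[(K * K)%type]} :=
  bilin_ext (fun p p' => tens (m << p.1 >> << p'.1 >>) (m << p.2 >> << p'.2 >>))
    z z'.

End FreeModules.

Section HopfAlgebras.
Variables (k : fieldType) (K : choiceType).
Local Notation V := {malg k[K]}.
Local Notation VV := {malg k[(K * K)%type]}.

Record hopf_data := HopfData {
  hmul : V -> V -> V;
  hone : V;
  hcomul : V -> VV;
  hcounit : V -> k
}.

Variable H : hopf_data.

Definition hmul_tens (z : VV) : V :=
  lin_ext (fun p => hmul H << p.1 >> << p.2 >>) z.

Definition is_antipode (S : V -> V) : Prop :=
  [/\ linear S,
      forall x, hmul_tens (tens_map S id (hcomul H x)) = hcounit H x *: hone H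
    & forall x, hmul_tens (tens_map id S (hcomul H x)) = hcounit H x *: hone H].

Record is_hopf_algebra : Prop := IsHopfAlgebra {
  hmul_linearl : forall y, linear (fun x => hmul H x y);
  hmul_linearr : forall x, linear (hmul H x);
  hmulA : associative (hmul H);
  hmul1l : left_id (hone H) (hmul H);
  hmul1r : right_id (hone H) (hmul H);
  hcomul_linear : linear (hcomul H);
  hcounit_linear : scalar (hcounit H);
  hcoassoc : forall x, tens_assoc (tens_map (hcomul H) id (hcomul H x))
                       = tens_map id (hcomul H) (hcomul H x);
  hcounitl : forall x,
    lin_ext (fun p => hcounit H << p.1 >> *: << p.2 >>) (hcomul H x) = x;
  hcounitr : forall x,
    lin_ext (fun p => hcounit H << p.2 >> *: << p.1 >>) (hcomul H x) = x;
  hcomulM : forall x y, hcomul H (hmul H x y)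
                        = tens_mul (hmul H) (hcomul H x) (hcomul H y);
  hcomul1 : hcomul H (hone H) = tens (hone H) (hone H);
  hcounitM : forall x y, hcounit H (hmul H x y) = hcounit H x * hcounit H y;
  hcounit1 : hcounit H (hone H) = 1;
  hantipode : exists S, is_antipode S
}.

End HopfAlgebras.

Record is_hopf_isomorphism (k : fieldType) (K L : choiceType)
    (H : hopf_data k K) (H' : hopf_data k L)
    (f : {malg k[K]} -> {malg k[L]}) : Prop := IsHopfIsomorphism {
  hiso_source : is_hopf_algebra H;
  hiso_target : is_hopf_algebra H';
  hiso_linear : linear f;
  hiso_bij : bijective f;
  hisoM : forall x y, f (hmul H x y) = hmul H' (f x) (f y);
  hiso1 : f (hone H) = hone H';
  hiso_comul : forall x, hcomul H' (f x) = tens_map f f (hcomul H x);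
  hiso_counit : forall x, hcounit H' (f x) = hcounit H x;
  hiso_antipode : forall S S', is_antipode H S -> is_antipode H' S' ->
    forall x, f (S x) = S' (f x)
}.

(* {fmonom A} is the free monoid on A, so that {malg k[{fmonom A}]} is
   k<A> and its ring product is concatenation.  The set A together with 0
   is option A, None being 0. *)
Section QuasiShuffle.
Variables (k : fieldType) (A : choiceType) (deg : A -> nat).
Variable br : option A -> option A -> option A.
Local Notation W := {fmonom A}.
Local Notation NC := {malg k[{fmonom A}]}.
Local Notation NC2 := {malg k[(W * W)%type]}.

Definition word (s : seq A) : NC := << FMonom s >>.
Definition letter (a : A) : NC := word [:: a].
Definition letter0 (a : option A) : NC := oapp letter 0 a.

Definition wdeg (s : seq A) : nat := (\sum_(a <- s) deg a)%N.

Fixpoint qprod_word (q : k) (u : seq A) {struct u} : seq A -> NC :=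
  fix aux (v : seq A) : NC :=
    match u, v with
    | [::], _ => word v
    | _ :: _, [::] => word u
    | a :: u', b :: v' =>
        letter a * qprod_word q u' v
        + q ^+ (wdeg u * deg b) *: (letter b * aux v')
        + q ^+ (wdeg u' * deg b) *:
            (letter0 (br (Some a) (Some b)) * qprod_word q u' v')
    end.

Definition qprod (q : k) : NC -> NC -> NC :=
  bilin_ext (fun u v : W => qprod_word q u v).

Definition Phi (q : k) : NC -> NC :=
  lin_ext (fun w : W => foldr (fun a x => qprod q (letter a) x) 1 w).

Definition generic (q : k) : Prop := bijective (Phi q).

Fixpoint shuffle_word (u : seq A) {struct u} : seq A -> NC :=
  fix aux (v : seq A) : NC :=
    match u, v with
    | [::], _ => word v
    | _ :: _, [::] => word u
    | a :: u', b :: v' => letter a * shuffle_word u' v + letter b * aux v'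
    end.

(* For fixed w only finitely many pairs of words contribute to the sum. *)
Definition delta : NC -> NC2 :=
  lin_ext (fun w : W =>
    \sum_(p \in [set: (W * W)%type]) (shuffle_word p.1 p.2)@_w *: << p >>).

Definition is_Delta (q : k) (D : NC -> NC2) : Prop :=
  [/\ linear D,
      D 1 = tens 1 1,
      forall a, D (letter a) = tens (letter a) 1 + tens 1 (letter a)
    & forall u v, D (qprod q u v) = tens_mul (qprod q) (D u) (D v)].

(* The map characterized by is_Delta q (and 0 if there is none). *)
Definition Delta (q : k) : NC -> NC2 := xget (fun=> 0) [set D | is_Delta q D].

Definition counit (x : NC) : k := x@_(FMonom [::]).

Definition conc_hopf : hopf_data k W := HopfData *%R 1 delta counit.

Definition qprod_hopf (q : k) : hopf_data k W :=
  HopfData (qprod q) 1 (Delta q) counit.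

End QuasiShuffle.

Arguments conc_hopf : clear implicits.

(* Main.v *)
Require Import Defs.
From HB Require Import structures.
From mathcomp Require Import all_boot all_order all_algebra.
From mathcomp Require Import finmap complex.
From mathcomp Require Import boolp classical_sets functions cardinality.
From mathcomp Require Import fsbigop reals ring.
From mathcomp.multinomials Require Import monalg.

(* [Phi_q] is multiplicative because [*_q] is associative, which is proved by
   comparing the recursive expansions of both bracketings; the exponents of [q]
   match because [u *_q v] is homogeneous of degree [|u| + |v|].  On the source,
   [delta (a x) = (a (x) 1 + 1 (x) a) delta x] gives all Hopf axioms by
   induction on words, the antipode being the signed reversal of words.  For
   generic [q] the Hopf structure is transported along the bijection [Phi_q];
   the transported comultiplication satisfies the conditions that determine
   [Delta_q], and these determine it since letters generate under [*_q]. *)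

Set Implicit Arguments.
Unset Strict Implicit.
Unset Printing Implicit Defensive.

Import GRing.Theory.

Local Open Scope ring_scope.

(** The notion of isomorphism used here demands compatibility with every pair of antipodes, not with
    chosen ones, so antipodes must be shown unique; this is the role of the convolution product.
    [Delta] is picked by [xget], so nothing can be said about it until a map with the defining
    properties has been exhibited. The rule for [delta] on a word beginning with [a] is the
    transpose of the fact that the first letter of a shuffle comes from one of the two factors. It
    is found by comparing coefficients, which also disposes of the sum over all pairs of words. The
    obstacle to associativity is that exponents of [q] contain the degree of the left factor. The
    recursion is given for a word on the left, but expanding [(u *_q v) *_q w] puts a sum of words
    there. One exponent serves all of them only because the sum is homogeneous, and this is where
    (S3) enters. *)

Section LinearProp.
Variables (k : fieldType) (U V : lmodType k) (f : U -> V).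
Hypothesis lf : linear f.

Definition linear_of : {linear U -> V} :=
  HB.pack f (GRing.isLinear.Build k U V *:%R f lf).

Lemma linear_fun0 : f 0 = 0.
Proof. exact: (linear0 linear_of). Qed.

Lemma linear_funD x y : f (x + y) = f x + f y.
Proof. exact: (linearD linear_of). Qed.

Lemma linear_funZ c x : f (c *: x) = c *: f x.
Proof. exact: (linearZ_LR linear_of). Qed.

Lemma linear_fun_sum (I : Type) (r : seq I) (P : pred I) (F : I -> U) :
  f (\sum_(i <- r | P i) F i) = \sum_(i <- r | P i) f (F i).
Proof. exact: (linear_sum linear_of). Qed.

Lemma linear_can g : cancel f g -> cancel g f -> linear g.
Proof.
by move=> fK gK c x y; apply: (can_inj fK); rewrite lf !gK.
Qed.

End LinearProp.

Lemma linear_id (k : fieldType) (U : lmodType k) : linear (@id U).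
Proof. by []. Qed.

Lemma linear_comp (k : fieldType) (U V W : lmodType k)
    (f : V -> W) (g : U -> V) :
  linear f -> linear g -> linear (fun x => f (g x)).
Proof. by move=> lf lg c x y; rewrite lg lf. Qed.

Lemma linear_compl (k : fieldType) (U V W : lmodType k) (X : Type)
    (B : V -> X -> W) (g : U -> V) y :
  (forall z, linear (B^~ z)) -> linear g -> linear (fun x => B (g x) y).
Proof. by move=> lB lg; exact: (linear_comp (lB y) lg). Qed.

(** * Linear and bilinear extension from a basis *)

Section LinExt.
Variables (k : fieldType) (K : choiceType) (U : lmodType k).
Implicit Types (f : K -> U) (x : {malg k[K]}).

Lemma malg_scaleU (c : k) (i : K) : << c *g i >> = c *: << i >> :> {malg k[K]}.
Proof. by apply/malgP => j; rewrite mcoeffZ !mcoeffU mulr_natr. Qed.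

Lemma malg_sum x : x = \sum_(i <- msupp x) x@_i *: << i >>.
Proof.
by rewrite {1}[x]monalgE; apply: eq_bigr => i _; rewrite malg_scaleU.
Qed.

(** Coefficients vanish off the support, so sums for different polynomials can be taken over one
    common finite set; linearity of [lin_ext] rests on this. *)
Lemma lin_extEw (d : {fset K}) f x : (msupp x `<=` d)%fset ->
  lin_ext f x = \sum_(i <- d) x@_i *: f i.
Proof.
move=> le; rewrite /lin_ext (big_fset_incl _ le) //= => i _ /mcoeff_outdom ->.
by rewrite scale0r.
Qed.

Lemma lin_ext_is_linear f : linear (lin_ext f).
Proof.
move=> c x y.
pose d := (msupp x `|` (msupp y `|` msupp (c *: x + y)))%fset.
have dx : (msupp x `<=` d)%fset by rewrite fsubsetUl.
have dy : (msupp y `<=` d)%fset by rewrite fsubsetU // fsubsetUl orbT.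
have dz : (msupp (c *: x + y) `<=` d)%fset.
  by rewrite fsubsetU // [X in _ || X]fsubsetU ?orbT // fsubset_refl orbT.
rewrite (lin_extEw _ dx) (lin_extEw _ dy) (lin_extEw _ dz).
rewrite scaler_sumr -big_split /=; apply: eq_bigr => i _.
by rewrite mcoeffD mcoeffZ scalerDl scalerA.
Qed.

HB.instance Definition _ f :=
  GRing.isLinear.Build k _ U *:%R (lin_ext f) (lin_ext_is_linear f).

Lemma lin_extU f i : lin_ext f << i >> = f i.
Proof. by rewrite /lin_ext msuppU oner_eq0 big_seq_fset1 mcoeffUU scale1r. Qed.

Lemma eq_lin_ext f g : f =1 g -> lin_ext f =1 lin_ext g.
Proof. by move=> fg x; apply: eq_bigr => i _; rewrite fg. Qed.

Lemma linear_ext (g h : {malg k[K]} -> U) : linear g -> linear h ->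
  (forall i, g << i >> = h << i >>) -> g =1 h.
Proof.
move=> lg lh gh x; rewrite [x]malg_sum !linear_fun_sum //.
by apply: eq_bigr => i _; rewrite !linear_funZ // gh.
Qed.

End LinExt.

Section BilinExt.
Variables (k : fieldType) (K L : choiceType) (U : lmodType k) (f : K -> L -> U).

Lemma bilin_extPl y : linear (fun x => bilin_ext f x y).
Proof. exact: lin_ext_is_linear. Qed.

Lemma bilin_extPr x : linear (bilin_ext f x).
Proof.
move=> c y z; rewrite /bilin_ext {1 3 5}/lin_ext.
rewrite scaler_sumr -big_split /=; apply: eq_bigr => i _.
by rewrite linearP scalerDr !scalerA mulrC.
Qed.

Lemma bilin_extU i j : bilin_ext f << i >> << j >> = f i j.
Proof. by rewrite /bilin_ext !lin_extU. Qed.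

End BilinExt.

(** * Tensor products of free modules and of maps between them *)

Section Tensors.
Variable k : fieldType.

Lemma tensPl (K L : choiceType) (y : {malg k[L]}) :
  linear (fun x : {malg k[K]} => tens x y).
Proof. exact: bilin_extPl. Qed.

Lemma tensPr (K L : choiceType) (x : {malg k[K]}) :
  linear (fun y : {malg k[L]} => tens x y).
Proof. exact: bilin_extPr. Qed.

Lemma tensU (K L : choiceType) (i : K) (j : L) :
  tens << i >> << j >> = << (i, j) >> :> {malg k[(K * L)%type]}.
Proof. exact: bilin_extU. Qed.

Lemma tens_ext (K L : choiceType) (U : lmodType k)
    (F G : {malg k[(K * L)%type]} -> U) : linear F -> linear G ->
  (forall x y, F (tens x y) = G (tens x y)) -> F =1 G.
Proof.
by move=> lF lG FG; apply: linear_ext => // -[i j]; rewrite -tensU.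
Qed.

(** The universal property of the tensor product; it evaluates maps given on pairs of basis elements
    at arbitrary pure tensors. *)
Lemma lin_ext_tens (K L : choiceType) (U : lmodType k)
    (B : {malg k[K]} -> {malg k[L]} -> U) :
  (forall y, linear (B^~ y)) -> (forall x, linear (B x)) ->
  forall x y, lin_ext (fun p => B << p.1 >> << p.2 >>) (tens x y) = B x y.
Proof.
move=> Bl Br x y; move: x; apply: linear_ext => [||i].
- by apply: linear_comp; [exact: lin_ext_is_linear | exact: tensPl].
- exact: Bl.
- move: y; apply: linear_ext => [||j]; last by rewrite tensU lin_extU.
    by apply: linear_comp; [exact: lin_ext_is_linear | exact: tensPr].
  exact: Br.
Qed.

Section TensMap.
Variables K L K' L' : choiceType.
Implicit Types (f : {malg k[K]} -> {malg k[K']}).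
Implicit Types (g : {malg k[L]} -> {malg k[L']}).

Lemma tens_mapP f g : linear (tens_map f g).
Proof. exact: lin_ext_is_linear. Qed.

Lemma tens_mapE f g x y : linear f -> linear g ->
  tens_map f g (tens x y) = tens (f x) (g y).
Proof.
move=> lf lg; apply: (lin_ext_tens (B := fun x y => tens (f x) (g y))) => *.
  by apply: linear_compl => //; exact: tensPl.
by apply: linear_comp => //; exact: tensPr.
Qed.

Lemma eq_tens_map f f' g g' : f =1 f' -> g =1 g' ->
  tens_map f g =1 tens_map f' g'.
Proof. by move=> ff gg; apply: eq_lin_ext => p; rewrite ff gg. Qed.

End TensMap.

Lemma tens_map_comp (K L K' L' K'' L'' : choiceType)
    (f : {malg k[K]} -> {malg k[K']}) (g : {malg k[L]} -> {malg k[L']})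
    (f' : {malg k[K']} -> {malg k[K'']})
    (g' : {malg k[L']} -> {malg k[L'']}) z :
  linear f -> linear g -> linear f' -> linear g' ->
  tens_map f' g' (tens_map f g z)
  = tens_map (fun x => f' (f x)) (fun y => g' (g y)) z.
Proof.
move=> lf lg lf' lg'; move: z; apply: tens_ext => [||x y].
- by apply: linear_comp; exact: tens_mapP.
- exact: tens_mapP.
- by rewrite !tens_mapE //; apply: linear_comp.
Qed.

Lemma tens_map_id (K L : choiceType) (z : {malg k[(K * L)%type]}) :
  tens_map id id z = z.
Proof.
move: z; apply: tens_ext => [||x y] //; first exact: tens_mapP.
by rewrite tens_mapE.
Qed.

Lemma tens_assocP (K L M : choiceType) : linear (@tens_assoc k K L M).
Proof. exact: lin_ext_is_linear. Qed.

Lemma tens_assocE (K L M : choiceType) (x : {malg k[K]}) (y : {malg k[L]})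
    (z : {malg k[M]}) : tens_assoc (tens (tens x y) z) = tens x (tens y z).
Proof.
move: z; apply: linear_ext => [||l].
- by apply: linear_comp; [exact: tens_assocP | exact: tensPr].
- by apply: linear_comp; exact: tensPr.
move: y; apply: linear_ext => [||j].
- apply: linear_comp; first exact: tens_assocP.
  by apply: linear_compl; [exact: tensPl | exact: tensPr].
- by apply: linear_comp; [exact: tensPr | exact: tensPl].
move: x; apply: linear_ext => [||i].
- apply: linear_comp; first exact: tens_assocP.
  by apply: linear_compl; exact: tensPl.
- exact: tensPl.
- by rewrite !tensU /tens_assoc lin_extU.
Qed.

Lemma tens_ext3 (K L M : choiceType) (U : lmodType k)
    (F G : {malg k[((K * L) * M)%type]} -> U) : linear F -> linear G ->
  (forall x y z, F (tens (tens x y) z) = G (tens (tens x y) z)) -> F =1 G.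
Proof.
by move=> lF lG FG; apply: linear_ext => // -[[i j] l]; rewrite -!tensU.
Qed.

Lemma tens_assoc_map (K L M K' L' M' : choiceType)
    (f : {malg k[K]} -> {malg k[K']}) (g : {malg k[L]} -> {malg k[L']})
    (h : {malg k[M]} -> {malg k[M']}) z :
  linear f -> linear g -> linear h ->
  tens_assoc (tens_map (tens_map f g) h z)
  = tens_map f (tens_map g h) (tens_assoc z).
Proof.
move=> lf lg lh; move: z; apply: tens_ext3 => [||x y z].
- by apply: linear_comp; [exact: tens_assocP | exact: tens_mapP].
- by apply: linear_comp; [exact: tens_mapP | exact: tens_assocP].
- by rewrite tens_assocE !(tens_mapE, tens_assocE) //; exact: tens_mapP.
Qed.

Section TensMul.
Variables (K : choiceType) (m : {malg k[K]} -> {malg k[K]} -> {malg k[K]}).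

Lemma tens_mulPl z : linear (fun y => tens_mul m y z).
Proof. exact: bilin_extPl. Qed.

Lemma tens_mulPr z : linear (tens_mul m z).
Proof. exact: bilin_extPr. Qed.

Hypotheses (ml : forall y, linear (m^~ y)) (mr : forall x, linear (m x)).

Lemma tens_mulE x y x' y' :
  tens_mul m (tens x y) (tens x' y') = tens (m x x') (m y y').
Proof.
move: x; apply: linear_ext => [||i].
- by apply: linear_compl;
    [exact: tens_mulPl | exact: tensPl].
- by apply: linear_compl; [exact: tensPl | exact: ml].
move: y; apply: linear_ext => [||j].
- by apply: linear_compl;
    [exact: tens_mulPl | exact: tensPr].
- by apply: linear_comp; [exact: tensPr | exact: ml].
move: x'; apply: linear_ext => [||i'].
- by apply: linear_comp; [exact: tens_mulPr | exact: tensPl].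
- by apply: linear_compl; [exact: tensPl | exact: mr].
move: y'; apply: linear_ext => [||j'].
- by apply: linear_comp; [exact: tens_mulPr | exact: tensPr].
- by apply: linear_comp; [exact: tensPr | exact: mr].
by rewrite !tensU /tens_mul bilin_extU.
Qed.

End TensMul.

Lemma tens_map_mul (K K' : choiceType)
    (m : {malg k[K]} -> {malg k[K]} -> {malg k[K]})
    (m' : {malg k[K']} -> {malg k[K']} -> {malg k[K']})
    (f : {malg k[K]} -> {malg k[K']}) z z' :
  (forall y, linear (m^~ y)) -> (forall x, linear (m x)) ->
  (forall y, linear (m'^~ y)) -> (forall x, linear (m' x)) ->
  linear f -> (forall x y, f (m x y) = m' (f x) (f y)) ->
  tens_map f f (tens_mul m z z')
  = tens_mul m' (tens_map f f z) (tens_map f f z').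
Proof.
move=> ml mr ml' mr' lf fM; move: z; apply: tens_ext => [||x y].
- by apply: linear_comp; [exact: tens_mapP | exact: tens_mulPl].
- by apply: linear_compl;
    [exact: tens_mulPl | exact: tens_mapP].
move: z'; apply: tens_ext => [||x' y'].
- by apply: linear_comp; [exact: tens_mapP | exact: tens_mulPr].
- by apply: linear_comp; [exact: tens_mulPr | exact: tens_mapP].
rewrite -> (tens_mulE ml mr), !(tens_mapE _ _ lf lf).
by rewrite -> (tens_mulE ml' mr'), !fM.
Qed.

End Tensors.

Lemma tens_mapDl (k : fieldType) (K L K' L' : choiceType)
    (f g : {malg k[K]} -> {malg k[K']}) (h : {malg k[L]} -> {malg k[L']}) z :
  tens_map (fun x => f x + g x) h z = tens_map f h z + tens_map g h z.
Proof.
rewrite /tens_map /lin_ext -big_split /=; apply: eq_bigr => p _.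
by rewrite -scalerDr (linear_funD (tensPl _)).
Qed.

Lemma tens_mapDr (k : fieldType) (K L K' L' : choiceType)
    (f : {malg k[K]} -> {malg k[K']}) (g h : {malg k[L]} -> {malg k[L']}) z :
  tens_map f (fun x => g x + h x) z = tens_map f g z + tens_map f h z.
Proof.
rewrite /tens_map /lin_ext -big_split /=; apply: eq_bigr => p _.
by rewrite -scalerDr (linear_funD (tensPr _)).
Qed.

Lemma linear_add_fun (k : fieldType) (U V : lmodType k) (f g : U -> V) :
  linear f -> linear g -> linear (fun x => f x + g x).
Proof.
by move=> lf lg c x y; rewrite lf lg scalerDr addrACA.
Qed.

(** The target [k^o] is the field as a module over itself, so that functionals such as coefficients
    and the counit fall under the extension lemmas for linear maps. *)
Lemma mcoeff_linear (k : fieldType) (K : choiceType) (i : K) :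
  linear (fun x : {malg k[K]} => x@_i : k^o).
Proof. by move=> c x y; rewrite mcoeffD mcoeffZ. Qed.

Lemma malg_mulPl (k : fieldType) (K : monomType) (y : {malg k[K]}) :
  linear ( *%R^~ y).
Proof. by move=> c x x'; rewrite mulrDl scalerAl. Qed.

Lemma malg_mulPr (k : fieldType) (K : monomType) (x : {malg k[K]}) :
  linear ( *%R x).
Proof.
(* Scalars cross the left factor because [k] is commutative; writing the product as a bilinear
   extension reduces this to [bilin_extPr]. *)
have mulE (y : {malg k[K]}) : x * y =
    bilin_ext (U := {malg k[K]}) (fun i j : K => << mmul i j >>) x y.
  rewrite malgME; apply: eq_bigr => i _.
  rewrite /lin_ext scaler_sumr; apply: eq_bigr => j _.
  by rewrite malg_scaleU scalerA.
by move=> c y z; rewrite !mulE bilin_extPr.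
Qed.

Section HmulTens.
Variables (k : fieldType) (K : choiceType) (H : hopf_data k K).

Lemma hmul_tensP : linear (hmul_tens H).
Proof. exact: lin_ext_is_linear. Qed.

Lemma hmul_tens_tens x y :
  (forall y, linear ((hmul H)^~ y)) -> (forall x, linear (hmul H x)) ->
  hmul_tens H (tens x y) = hmul H x y.
Proof. by move=> ml mr; exact: (lin_ext_tens ml mr). Qed.

End HmulTens.

Opaque lin_ext bilin_ext tens tens_map tens_assoc tens_mul hmul_tens.

(** * Convolution and uniqueness of the antipode *)

Section Convolution.
Variables (k : fieldType) (K : choiceType) (H : hopf_data k K).
Hypothesis hH : is_hopf_algebra H.
Local Notation V := {malg k[K]}.
Local Notation mu := (hmul_tens H).

Let mull := hmul_linearl hH.
Let mulr := hmul_linearr hH.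

Let hmul_tensE x y : mu (tens x y) = hmul H x y.
Proof. exact: hmul_tens_tens. Qed.

Lemma hmul_tensA z : mu (tens_map mu id z) = mu (tens_map id mu (tens_assoc z)).
Proof.
have lmu := hmul_tensP H.
move: z; apply: tens_ext3 => [||x y z].
- by apply: linear_comp => //; exact: tens_mapP.
- exact: (linear_comp lmu (linear_comp (tens_mapP _ _) (@tens_assocP _ _ _ _))).
rewrite tens_assocE (tens_mapE _ _ lmu (@linear_id _ _)).
rewrite (tens_mapE _ _ (@linear_id _ _) lmu).
by rewrite -> !hmul_tensE; rewrite -(hmulA hH).
Qed.

Definition convol (f g : V -> V) (x : V) : V := mu (tens_map f g (hcomul H x)).

Lemma convolA f g h x : linear f -> linear g -> linear h ->
  convol (convol f g) h x = convol f (convol g h) x.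
Proof.
move=> lf lg lh; have lmu := hmul_tensP H; have lD := hcomul_linear hH.
have lt (f' g' : V -> V) := tens_mapP f' g'.
have lid := @linear_id k V.
have lfg : linear (fun y => tens_map f g (hcomul H y)).
  exact: (linear_comp (lt f g) lD).
have lgh : linear (fun y => tens_map g h (hcomul H y)).
  exact: (linear_comp (lt g h) lD).
(* The intermediate expression keeps [f], [g], [h] apart: comultiply twice, apply them in the tensor
   cube, multiply twice. Associativity and coassociativity then move the brackets to the other
   side. *)
transitivity (mu (tens_map mu id
    (tens_map (tens_map f g) h (tens_map (hcomul H) id (hcomul H x))))).
  rewrite (tens_map_comp _ lD lid (lt f g) lh).
  by rewrite (tens_map_comp _ lfg lh lmu lid).
rewrite hmul_tensA (tens_assoc_map _ lf lg lh) (hcoassoc hH).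
rewrite (tens_map_comp _ lid lD lf (lt g h)).
by rewrite (tens_map_comp _ lf lgh lid lmu).
Qed.

(** The neutral element of convolution. *)
Let eps (x : V) : V := hcounit H x *: hone H.

Let epsP : linear eps.
Proof. by move=> c x y; rewrite /eps (hcounit_linear hH) scalerDl scalerA. Qed.

Lemma convol1r f x : linear f -> convol f eps x = f x.
Proof.
move=> lf; rewrite -{2}(hcounitr hH x) /convol; move: (hcomul H x) => z.
move: z; apply: linear_ext => [||[i j]].
- by apply: linear_comp; [exact: hmul_tensP | exact: tens_mapP].
- by apply: linear_comp => //; exact: lin_ext_is_linear.
rewrite lin_extU -tensU (tens_mapE _ _ lf epsP) hmul_tensE (linear_funZ lf).
by rewrite (linear_funZ (mulr _)) (hmul1r hH).
Qed.

Lemma convol1l f x : linear f -> convol eps f x = f x.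
Proof.
move=> lf; rewrite -{2}(hcounitl hH x) /convol; move: (hcomul H x) => z.
move: z; apply: linear_ext => [||[i j]].
- by apply: linear_comp; [exact: hmul_tensP | exact: tens_mapP].
- by apply: linear_comp => //; exact: lin_ext_is_linear.
rewrite lin_extU -tensU (tens_mapE _ _ epsP lf) hmul_tensE (linear_funZ lf).
by rewrite (linear_funZ (mull _)) (hmul1l hH).
Qed.

Lemma eq_convol f f' g g' : f =1 f' -> g =1 g' -> convol f g =1 convol f' g'.
Proof. by move=> ff gg x; rewrite /convol (eq_tens_map ff gg). Qed.

(** Under convolution [S] is a left inverse of the identity map and [S'] a right inverse, so S = S *
    (id * S') = (S * id) * S' = S'. *)
Lemma antipode_unique S S' : is_antipode H S -> is_antipode H S' -> S =1 S'.
Proof.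
case=> lS Sl _ [lS' _ Sr'] x.
rewrite -(convol1r _ lS) -(convol1l _ lS').
transitivity (convol S (convol id S') x).
  exact: (eq_convol (frefl S) (fun y => esym (Sr' y))).
rewrite -(convolA _ lS (@linear_id _ _) lS').
exact: (eq_convol Sl (frefl S')).
Qed.

End Convolution.

(** * Transport of a Hopf structure along a linear bijection *)

Section Transport.
Variables (k : fieldType) (K L : choiceType).
Variables (H : hopf_data k K) (H' : hopf_data k L).
Variables (f : {malg k[K]} -> {malg k[L]}) (g : {malg k[L]} -> {malg k[K]}).
Hypotheses (hH : is_hopf_algebra H) (lf : linear f).
Hypotheses (fK : cancel f g) (gK : cancel g f).
Hypothesis fM : forall x y, f (hmul H x y) = hmul H' (f x) (f y).
Hypothesis f1 : f (hone H) = hone H'.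
Hypothesis fD : forall x, hcomul H' (f x) = tens_map f f (hcomul H x).
Hypothesis fe : forall x, hcounit H' (f x) = hcounit H x.

Let lg : linear g := linear_can lf fK gK.

(** No axiom is assumed for [H']: each argument is written as [f (g x)] and the operations are
    pulled through [f] back to [H]. The remaining axioms follow the same pattern. *)
Let mull' y : linear ((hmul H')^~ y).
Proof.
move=> c x x'; rewrite -[x]gK -[x']gK -[y]gK -lf -!fM -lf.
by rewrite (hmul_linearl hH).
Qed.

Let mulr' x : linear (hmul H' x).
Proof.
move=> c y y'; rewrite -[x]gK -[y]gK -[y']gK -lf -!fM -lf.
by rewrite (hmul_linearr hH).
Qed.

Let comul' : linear (hcomul H').
Proof.
move=> c x y; rewrite -[x]gK -[y]gK -lf !fD (hcomul_linear hH).
exact: tens_mapP.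
Qed.

Lemma transport_hmul_tens z :
  hmul_tens H' (tens_map f f z) = f (hmul_tens H z).
Proof.
move: z; apply: tens_ext => [||x y].
- by apply: linear_comp; [exact: hmul_tensP | exact: tens_mapP].
- by apply: linear_comp => //; exact: hmul_tensP.
have ml := hmul_linearl hH; have mr := hmul_linearr hH.
by rewrite (tens_mapE _ _ lf lf) (hmul_tens_tens _ _ ml mr) hmul_tens_tens.
Qed.

Lemma transport_antipode S : is_antipode H S ->
  is_antipode H' (fun x => f (S (g x))).
Proof.
case=> lS Sl Sr.
have lS' : linear (fun x => f (S (g x))) by do 2!apply: linear_comp.
have lfS : linear (fun x => f (S x)) by apply: linear_comp.
have lid W := @linear_id k W.
have fSK y : f (S (g (f y))) = f (S y) by rewrite fK.
split=> [|x|x]; first exact: lS'.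
- rewrite -[x]gK fD fe -f1 -(linear_funZ lf) -Sl -transport_hmul_tens.
  rewrite (tens_map_comp _ lf lf lS' (lid _)).
  rewrite (tens_map_comp _ lS (lid _) lf lf).
  apply: (congr1 (hmul_tens H')).
  exact: (eq_tens_map (f' := fun y => f (S y)) fSK (frefl f)).
- rewrite -[x]gK fD fe -f1 -(linear_funZ lf) -Sr -transport_hmul_tens.
  rewrite (tens_map_comp _ lf lf (lid _) lS').
  rewrite (tens_map_comp _ (lid _) lS lf lf).
  apply: (congr1 (hmul_tens H')).
  exact: (eq_tens_map (g' := fun y => f (S y)) (frefl f) fSK).
Qed.

Lemma transport_hopf : is_hopf_algebra H'.
Proof.
have lD := hcomul_linear hH.
have lt f' g' := @tens_mapP k K K L L f' g'.
have ltK f' g' := @tens_mapP k K K K K f' g'.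
split.
- exact: mull'.
- exact: mulr'.
- move=> x y z; rewrite -[x]gK -[y]gK -[z]gK.
  by rewrite -!fM (hmulA hH).
- by move=> x; rewrite -[x]gK -f1 -fM (hmul1l hH).
- by move=> x; rewrite -[x]gK -f1 -fM (hmul1r hH).
- exact: comul'.
- by move=> c x y; rewrite -[x]gK -[y]gK -lf !fe (hcounit_linear hH).
- move=> x; rewrite -[x]gK fD.
  rewrite (tens_map_comp _ lf lf comul' (@linear_id _ _)).
  rewrite (tens_map_comp _ lf lf (@linear_id _ _) comul').
  (* Writing the second factor as [f (id x)] lets [tens_map_comp] be read backwards, so that [f] is
     applied after both comultiplications of [H]. *)
  rewrite (eq_tens_map fD (g' := fun x => f (id x)) (frefl _)).
  rewrite (eq_tens_map (f' := fun x => f (id x)) (frefl _) fD).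
  rewrite -(tens_map_comp _ lD (@linear_id _ _) (lt f f) lf).
  rewrite -(tens_map_comp _ (@linear_id _ _) lD lf (lt f f)).
  by rewrite (tens_assoc_map _ lf lf lf) (hcoassoc hH).
- move=> x; rewrite -[x]gK fD -{2}(hcounitl hH (g x)).
  move: (hcomul H (g x)); apply: tens_ext => [||a b].
  + by apply: linear_comp; [exact: lin_ext_is_linear | exact: tens_mapP].
  + by apply: linear_comp => //; exact: lin_ext_is_linear.
  rewrite (tens_mapE _ _ lf lf).
  rewrite (lin_ext_tens (B := fun x y => hcounit H' x *: y)).
  + rewrite (lin_ext_tens (B := fun x y => hcounit H x *: y))
      ?fe ?(linear_funZ lf) //.
    * by move=> y c u v; rewrite (hcounit_linear hH) scalerDl scalerA.
    * by move=> y c u v; rewrite scalerDr !scalerA mulrC.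
  + move=> y c u v; rewrite -[u]gK -[v]gK -lf !fe.
    by rewrite (hcounit_linear hH) scalerDl scalerA.
  + by move=> y c u v; rewrite scalerDr !scalerA mulrC.
- move=> x; rewrite -[x]gK fD -{2}(hcounitr hH (g x)).
  move: (hcomul H (g x)); apply: tens_ext => [||a b].
  + by apply: linear_comp; [exact: lin_ext_is_linear | exact: tens_mapP].
  + by apply: linear_comp => //; exact: lin_ext_is_linear.
  rewrite (tens_mapE _ _ lf lf).
  rewrite (lin_ext_tens (B := fun x y => hcounit H' y *: x)).
  + rewrite (lin_ext_tens (B := fun x y => hcounit H y *: x))
      ?fe ?(linear_funZ lf) //.
    * by move=> y c u v; rewrite scalerDr !scalerA mulrC.
    * by move=> y c u v; rewrite (hcounit_linear hH) scalerDl scalerA.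
  + by move=> y c u v; rewrite scalerDr !scalerA mulrC.
  + move=> y c u v; rewrite -[u]gK -[v]gK -lf !fe.
    by rewrite (hcounit_linear hH) scalerDl scalerA.
- move=> x y; rewrite -[x]gK -[y]gK -fM !fD (hcomulM hH).
  apply: tens_map_mul => //; [exact: hmul_linearl hH|exact: hmul_linearr hH].
- by rewrite -f1 fD (hcomul1 hH) (tens_mapE _ _ lf lf).
- by move=> x y; rewrite -[x]gK -[y]gK -fM !fe (hcounitM hH).
- by rewrite -f1 fe (hcounit1 hH).
- by have [S /transport_antipode hS] := hantipode hH; eexists; exact: hS.
Qed.

Lemma transport_hopf_isomorphism : is_hopf_isomorphism H H' f.
Proof.
split=> //; first exact: transport_hopf.
- by exists g.
(* The conjugate of [S] by [f] is an antipode of [H'], hence equals [S'] by uniqueness; it is then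
   evaluated at [f x]. *)
- move=> S S' /transport_antipode hS hS' x.
  by rewrite -(antipode_unique transport_hopf hS hS') fK.
Qed.

End Transport.

(** Inductive step for coassociativity, with [l] the left multiplication by a letter. Moving l (x) 1
    + 1 (x) l past either iterated comultiplication yields the same operator l (x) 1 (x) 1 + 1 (x) l
    (x) 1 + 1 (x) 1 (x) l on the tensor cube. *)
Lemma coassoc_step (k : fieldType) (K : choiceType)
    (D : {malg k[K]} -> {malg k[(K * K)%type]})
    (l : {malg k[K]} -> {malg k[K]}) (z : {malg k[(K * K)%type]}) :
  linear D -> linear l ->
  (forall x, D (l x) = tens_map l id (D x) + tens_map id l (D x)) ->
  tens_assoc (tens_map D id z) = tens_map id D z ->
  tens_assoc (tens_map D id (tens_map l id z + tens_map id l z))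
  = tens_map id D (tens_map l id z + tens_map id l z).
Proof.
move=> lD ll Dl IH.
pose P y : {malg k[(K * K)%type]} := tens_map l id y + tens_map id l y.
have lP : linear P by apply: linear_add_fun; exact: tens_mapP.
have lid : linear (@id {malg k[K]}) by [].
have lid2 : linear (@id {malg k[(K * K)%type]}) by [].
have -> : tens_map D id (tens_map l id z + tens_map id l z)
    = tens_map P id (tens_map D id z) + tens_map id l (tens_map D id z).
  rewrite (linear_funD (tens_mapP _ _)).
  rewrite -> (tens_map_comp z ll lid lD lid), (tens_map_comp z lid ll lD lid).
  rewrite -> (tens_map_comp z lD lid lP lid), (tens_map_comp z lD lid lid2 ll).
  by rewrite -> (eq_tens_map Dl (frefl _)).
have -> : tens_map id D (tens_map l id z + tens_map id l z)
    = tens_map l id (tens_map id D z) + tens_map id P (tens_map id D z).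
  rewrite (linear_funD (tens_mapP _ _)).
  rewrite -> (tens_map_comp z ll lid lid lD), (tens_map_comp z lid ll lid lD).
  rewrite -> (tens_map_comp z lid lD lid lP), (tens_map_comp z lid lD ll lid2).
  by rewrite -> (eq_tens_map (frefl _) Dl).
rewrite -IH; move: (tens_map D id z) => t.
rewrite /P tens_mapDl tens_mapDr !(linear_funD (@tens_assocP _ _ _ _)).
rewrite -> (tens_assoc_map t ll lid lid), (tens_assoc_map t lid ll lid).
have tid : tens_map id id =1 @id {malg k[(K * K)%type]} by exact: tens_map_id.
rewrite -> (eq_tens_map (frefl l) tid); rewrite -addrA.
do 2!apply: (congr1 (+%R _)).
rewrite <- (tens_assoc_map t lid lid ll).
by rewrite -> (eq_tens_map tid (frefl l)).
Qed.

(** * The concatenation Hopf algebra *)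

Section Concatenation.
Variables (k : fieldType) (A : choiceType).
Local Notation W := {fmonom A}.
Local Notation NC := {malg k[{fmonom A}]}.
Local Notation NC2 := {malg k[(W * W)%type]}.
Local Notation word := (@word k A).
Local Notation letter := (@letter k A).
Local Notation delta := (@delta k A).
Local Notation counit := (@counit k A).
Implicit Types (a b : A) (s u v : seq A) (x y : NC) (z : NC2).

Lemma word_nil : word [::] = 1.
Proof. by rewrite /word -fmoneE. Qed.

Lemma word_cat s u : word (s ++ u) = word s * word u.
Proof. have E : FMonom (s ++ u) = mmul (FMonom s) (FMonom u).
  by rewrite -[RHS]/(fmmul _ _) fmmulE.
by rewrite /Defs.word E malgM_def fgmulUU mulr1. Qed.

Lemma word_cons a s : word (a :: s) = letter a * word s.
Proof. by rewrite -cat1s word_cat. Qed.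

Lemma word_ext (U : lmodType k) (F G : NC -> U) : linear F -> linear G ->
  (forall s, F (word s) = G (word s)) -> F =1 G.
Proof.
by move=> lF lG FG; apply: linear_ext => // w; rewrite -[w]fmK; exact: FG.
Qed.

Lemma word_coef s u : (word s)@_(FMonom u) = (s == u)%:R.
Proof. by rewrite mcoeffU1 fmP. Qed.

Lemma letter_mul_coef a x u : (letter a * x)@_(FMonom u) =
  if u is b :: u' then (a == b)%:R * x@_(FMonom u') else 0.
Proof.
move: x; apply: (word_ext (U := k^o)) => [||s].
- by apply: (linear_comp (mcoeff_linear _)); exact: malg_mulPr.
- case: u => [|b u]; first by move=> c x y; rewrite scaler0 addr0.
  move=> c x y; rewrite mcoeffD mcoeffZ mulrDr; congr (_ + _).
  by rewrite mulrCA.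
rewrite -word_cons word_coef; case: u => [|b u]; first by [].
by rewrite eqseq_cons word_coef -natrM mulnb.
Qed.

Lemma shuffle0s u : @shuffle_word k A [::] u = word u.
Proof. by case: u. Qed.

Lemma shuffles0 u : @shuffle_word k A u [::] = word u.
Proof. by case: u. Qed.

Lemma shuffle_coef_nil u v :
  (@shuffle_word k A u v)@_(FMonom [::]) = ((u == [::]) && (v == [::]))%:R.
Proof.
case: u v => [|a u] [|b v]; rewrite ?shuffle0s ?shuffles0 ?word_coef //.
by rewrite /= mcoeffD; rewrite -> !letter_mul_coef; rewrite addr0.
Qed.

(** The first letter of a shuffle comes from [u] or from [v]. Recursion on the target word, with
    empty factors included, is the form that matches [primitive_mul_coef]. *)
Lemma shuffle_coef_cons a s u v :
  (@shuffle_word k A u v)@_(FMonom (a :: s)) =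
    (if u is b :: u' then (a == b)%:R * (@shuffle_word k A u' v)@_(FMonom s)
     else 0)
  + (if v is b :: v' then (a == b)%:R * (@shuffle_word k A u v')@_(FMonom s)
     else 0).
Proof.
case: u v => [|b u] [|c v].
- by rewrite shuffle0s word_coef addr0.
- by rewrite !shuffle0s word_cons letter_mul_coef eq_sym add0r.
- by rewrite !shuffles0 word_cons letter_mul_coef eq_sym addr0.
- by rewrite [shuffle_word _ _]/= mcoeffD; rewrite -> !letter_mul_coef;
    rewrite ![_ == a]eq_sym.
Qed.

(* Left multiplication by [a (x) 1 + 1 (x) a]. *)
Definition primitive_mul a z : NC2 :=
  tens_map ( *%R (letter a)) id z + tens_map id ( *%R (letter a)) z.

Lemma primitive_mulP a : linear (primitive_mul a).
Proof. by apply: linear_add_fun; exact: tens_mapP. Qed.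

Lemma tens_word_coef s t u v :
  (tens (word s) (word t))@_(FMonom u, FMonom v) = ((s == u) && (t == v))%:R.
Proof. by rewrite tensU mcoeffU xpair_eqE !fmP. Qed.

Lemma word2_ext (U : lmodType k) (F G : NC2 -> U) : linear F -> linear G ->
  (forall s t, F (tens (word s) (word t)) = G (tens (word s) (word t))) ->
  F =1 G.
Proof.
move=> lF lG FG; apply: linear_ext => // -[s t].
by rewrite -[s]fmK -[t]fmK -tensU; exact: FG.
Qed.

Let mul_linear a : linear ( *%R (letter a)).
Proof. exact: malg_mulPr. Qed.

Let id_linear : linear (@id NC).
Proof. by []. Qed.

Lemma primitive_mulE a x y :
  primitive_mul a (tens x y) = tens (letter a * x) y + tens x (letter a * y).
Proof.
rewrite /primitive_mul (tens_mapE _ _ (mul_linear a) id_linear).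
by rewrite (tens_mapE _ _ id_linear (mul_linear a)).
Qed.

Lemma primitive_mul_coef a z u v : (primitive_mul a z)@_(FMonom u, FMonom v) =
    (if u is b :: u' then (a == b)%:R * z@_(FMonom u', FMonom v) else 0)
  + (if v is b :: v' then (a == b)%:R * z@_(FMonom u, FMonom v') else 0).
Proof.
move: z; apply: (word2_ext (U := k^o)) => [||s t].
- by apply: (linear_comp (mcoeff_linear _)); exact: primitive_mulP.
- apply: (linear_add_fun (V := k^o)).
    case: u => [|b u] c x y; first by rewrite scaler0 addr0.
    by rewrite mcoeffD mcoeffZ mulrDr mulrCA.
  case: v => [|b v] c x y; first by rewrite scaler0 addr0.
  by rewrite mcoeffD mcoeffZ mulrDr mulrCA.
rewrite primitive_mulE mcoeffD; rewrite <- !word_cons.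
rewrite -> !tens_word_coef.
congr (_ + _).
  by case: u => // b w; rewrite eqseq_cons tens_word_coef -natrM mulnb andbA.
case: v => [|b w]; first by rewrite andbF.
by rewrite eqseq_cons tens_word_coef -natrM mulnb andbCA.
Qed.

(** The value of [delta] on a word, as the product of the elements a (x) 1 + 1 (x) a over its
    letters; a recursive substitute for the sum over all pairs of words. *)
Definition delta_word s : NC2 := foldr primitive_mul (tens 1 1) s.

Lemma delta_word_coef s u v :
  (delta_word s)@_(FMonom u, FMonom v) = (@shuffle_word k A u v)@_(FMonom s).
Proof.
elim: s u v => [|a s IH] u v.
  rewrite /delta_word /= -word_nil tens_word_coef shuffle_coef_nil.
  by rewrite ![[::] == _]eq_sym.
rewrite primitive_mul_coef shuffle_coef_cons.
by congr (_ + _); [case: u | case: v] => // b w; rewrite IH.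
Qed.

Lemma deltaP : linear delta.
Proof. exact: lin_ext_is_linear. Qed.

Lemma deltaE s : delta (word s) = delta_word s.
Proof.
(* By [delta_word_coef] the shuffle coefficients vanish outside the support of [delta_word s], so
   the sum over all pairs becomes a finite one. *)
rewrite /delta lin_extU /= (fsbigTE (msupp (delta_word s))) => [|[u v]].
  rewrite [RHS]malg_sum; apply: eq_bigr => -[[u] [v]] _.
  by rewrite -delta_word_coef.
case: u v => [u] [v]; rewrite -mcoeff_eq0 delta_word_coef => /eqP /= ->.
by rewrite scale0r.
Qed.

Lemma delta1 : delta 1 = tens 1 1.
Proof. by rewrite -word_nil deltaE word_nil. Qed.

Lemma delta_letter_mul a x : delta (letter a * x) = primitive_mul a (delta x).
Proof.
move: x; apply: word_ext => [||s].
- by apply: linear_comp; [exact: deltaP | exact: malg_mulPr].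
- by apply: linear_comp; [exact: primitive_mulP | exact: deltaP].
by rewrite -word_cons !deltaE.
Qed.

Lemma delta_letter a :
  delta (letter a) = tens (letter a) 1 + tens 1 (letter a).
Proof.
by rewrite -{1}[letter a]mulr1 delta_letter_mul delta1 primitive_mulE mulr1.
Qed.

Lemma delta_coassoc x :
  tens_assoc (tens_map delta id (delta x)) = tens_map id delta (delta x).
Proof.
have lD := deltaP; have lP := primitive_mulP.
have lt f' g' := @tens_mapP k W W W W f' g'.
move: x; apply: word_ext => [||s].
- apply: linear_comp; first exact: tens_assocP.
  by apply: linear_comp => //; exact: tens_mapP.
- by apply: linear_comp => //; exact: tens_mapP.
elim: s => [|a s IH].
  rewrite word_nil delta1 (tens_mapE _ _ lD id_linear).
  by rewrite (tens_mapE _ _ id_linear lD) delta1 tens_assocE.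
rewrite word_cons delta_letter_mul.
exact: (coassoc_step lD (mul_linear a) (delta_letter_mul a) IH).
Qed.

Lemma counit_scalar : linear (counit : NC -> k^o).
Proof. exact: mcoeff_linear. Qed.

Lemma counit_letter_mul a x : counit (letter a * x) = 0.
Proof. by rewrite /counit letter_mul_coef. Qed.

Lemma counit1 : counit 1 = 1.
Proof. by rewrite /counit -word_nil word_coef. Qed.

Lemma counitM x y : counit (x * y) = counit x * counit y.
Proof.
by rewrite /counit -fmoneE; exact: (mcoeff1g_is_multiplicative _ _).1.
Qed.

Lemma counit_bilinl : forall y : NC, linear (fun x => counit x *: y).
Proof. by move=> y c u v; rewrite counit_scalar scalerDl scalerA. Qed.

Lemma counit_bilinr : forall x : NC, linear (fun y : NC => counit x *: y).
Proof. by move=> x c u v; rewrite scalerDr !scalerA mulrC. Qed.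

Lemma delta_counitl x :
  lin_ext (fun p => counit << p.1 >> *: << p.2 >>) (delta x) = x.
Proof.
have lD := deltaP.
have E := lin_ext_tens counit_bilinl counit_bilinr.
move: x; apply: word_ext => [||s] //.
  by apply: linear_comp => //; exact: lin_ext_is_linear.
elim: s => [|a s IH].
  by rewrite word_nil delta1 E counit1 scale1r.
rewrite word_cons -{2}IH delta_letter_mul; move: (delta (word s)).
apply: tens_ext => [||x y].
- by apply: linear_comp; [exact: lin_ext_is_linear | exact: primitive_mulP].
- by apply: linear_comp; [exact: malg_mulPr | exact: lin_ext_is_linear].
(* The counit kills the term with [a] prepended to the left factor; the other one is [a] times the
   induction hypothesis. *)
rewrite primitive_mulE (linear_funD (lin_ext_is_linear _)).
rewrite -> !E, counit_letter_mul.
by rewrite scale0r add0r (linear_funZ (mul_linear a)).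
Qed.

Lemma delta_counitr x :
  lin_ext (fun p => counit << p.2 >> *: << p.1 >>) (delta x) = x.
Proof.
have lD := deltaP.
have E := lin_ext_tens (B := fun x y => counit y *: x)
            counit_bilinr counit_bilinl.
move: x; apply: word_ext => [||s] //.
  by apply: linear_comp => //; exact: lin_ext_is_linear.
elim: s => [|a s IH].
  by rewrite word_nil delta1 E counit1 scale1r.
rewrite word_cons -{2}IH delta_letter_mul; move: (delta (word s)).
apply: tens_ext => [||x y].
- by apply: linear_comp; [exact: lin_ext_is_linear | exact: primitive_mulP].
- by apply: linear_comp; [exact: malg_mulPr | exact: lin_ext_is_linear].
rewrite primitive_mulE (linear_funD (lin_ext_is_linear _)).
rewrite -> !E, counit_letter_mul.
by rewrite scale0r addr0 (linear_funZ (mul_linear a)).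
Qed.

(** Associativity in the tensor square, as [primitive_mul a] is a left multiplication there. *)
Lemma primitive_mulA a z z' :
  tens_mul *%R (primitive_mul a z) z' = primitive_mul a (tens_mul *%R z z').
Proof.
have ml := @malg_mulPl k W; have mr := @malg_mulPr k W.
have lP := primitive_mulP.
move: z; apply: tens_ext => [||x y].
- by apply: linear_compl; [exact: tens_mulPl | exact: lP].
- exact: (linear_comp (lP a) (tens_mulPl _ _)).
move: z'; apply: tens_ext => [||x' y'].
- exact: tens_mulPr.
- exact: (linear_comp (lP a) (tens_mulPr _ _)).
have E := tens_mulE ml mr.
rewrite primitive_mulE (linear_funD (tens_mulPl _ _)).
by rewrite -> !E, primitive_mulE, !mulrA.
Qed.

Lemma deltaM x y : delta (x * y) = tens_mul *%R (delta x) (delta y).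
Proof.
have ml := @malg_mulPl k W; have mr := @malg_mulPr k W.
have lD := deltaP.
move: x; apply: word_ext => [||s].
- by apply: linear_comp.
- by apply: linear_compl; [exact: tens_mulPl | exact: lD].
elim: s => [|a s IH]; last first.
  rewrite word_cons -mulrA; rewrite -> !delta_letter_mul.
  by rewrite IH primitive_mulA.
rewrite word_nil mul1r delta1; move: (delta y).
apply: tens_ext => [||u v]; [exact: linear_id | exact: tens_mulPr |].
by rewrite (tens_mulE ml mr) !mul1r.
Qed.

(** Forced by primitivity of the letters: [a] must go to [- a], and an antipode reverses
    products. *)
Definition conc_antipode : NC -> NC :=
  lin_ext (fun w : W => (-1) ^+ size w *: word (rev w)).

Lemma conc_antipodeP : linear conc_antipode.
Proof. exact: lin_ext_is_linear. Qed.

Lemma conc_antipode1 : conc_antipode 1 = 1.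
Proof. by rewrite -word_nil /conc_antipode lin_extU scale1r. Qed.

Lemma conc_antipode_letter_mul a x :
  conc_antipode (letter a * x) = - (conc_antipode x * letter a).
Proof.
move: x; apply: word_ext => [||s].
- by apply: linear_comp; [exact: conc_antipodeP | exact: malg_mulPr].
- move=> c x y; rewrite conc_antipodeP malg_mulPl opprD -scalerN //.
rewrite -word_cons /conc_antipode !lin_extU /= rev_cons -cats1 word_cat.
by rewrite exprS mulN1r scaleNr -scalerAl.
Qed.

Lemma conc_antipode_is_antipode : is_antipode (conc_hopf k A) conc_antipode.
Proof.
have ml := @malg_mulPl k W; have mr := @malg_mulPr k W.
have lS := conc_antipodeP; have lD := deltaP.
have lP := primitive_mulP.
have lt f' g' := @tens_mapP k W W W W f' g'.
have lmu : linear (hmul_tens (conc_hopf k A)) by exact: lin_ext_is_linear.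
have muE x y : hmul_tens (conc_hopf k A) (tens x y) = x * y.
  exact: (lin_ext_tens ml mr).
have leta : linear (fun x : NC => counit x *: (1 : NC)) by exact: counit_bilinl.
have SlE x y : tens_map conc_antipode id (tens x y) = tens (conc_antipode x) y.
  exact: tens_mapE.
have SrE x y : tens_map id conc_antipode (tens x y) = tens x (conc_antipode y).
  exact: tens_mapE.
have eta1 : counit 1 *: 1 = 1 :> NC by rewrite counit1 scale1r.
split=> [|x|x]; [exact: lS | |]; rewrite [hcomul _]/= [hcounit _]/= [hone _]/=;
  move: x; apply: word_ext.
- exact: (linear_comp lmu (linear_comp (lt _ _) lD)).
- exact: leta.
- case=> [|a s].
    by rewrite word_nil delta1 SlE muE conc_antipode1 eta1 mulr1.
  rewrite word_cons counit_letter_mul scale0r delta_letter_mul.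
  move: (delta (word s)); apply: tens_ext => [||x y].
  + exact: (linear_comp lmu (linear_comp (lt _ _) (lP a))).
  + by move=> c u v; rewrite scaler0 addr0.
  rewrite primitive_mulE (linear_funD (lt _ _)) (linear_funD lmu).
  rewrite -> !SlE, !muE, conc_antipode_letter_mul.
  by rewrite mulNr mulrA addNr.
- exact: (linear_comp lmu (linear_comp (lt _ _) lD)).
- exact: leta.
elim=> [|a s IH].
  by rewrite word_nil delta1 SrE muE conc_antipode1 eta1 mulr1.
rewrite word_cons counit_letter_mul scale0r delta_letter_mul.
(* Here prepending [a] produces a x S(y) - x S(y) a, which need not cancel on a single tensor.
   Summed over [delta (word s)] it is the commutator of [a] with a scalar, by the induction
   hypothesis. *)
transitivity
  (letter a * (counit (word s) *: 1) - counit (word s) *: 1 * letter a);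
  last by rewrite (linear_funZ (mr _)) mulr1 -scalerAl mul1r subrr.
rewrite -IH; move: (delta (word s)) => {IH}; apply: tens_ext => [||x y].
- exact: (linear_comp lmu (linear_comp (lt _ _) (lP a))).
- move=> c u v; rewrite (lt _ _) lmu mr ml scalerBr opprD !addrA.
  by congr (_ + _); rewrite addrAC.
rewrite primitive_mulE (linear_funD (lt _ _)) (linear_funD lmu).
rewrite -> !SrE, !muE, conc_antipode_letter_mul.
by rewrite mulrN !mulrA.
Qed.

Lemma conc_is_hopf_algebra : is_hopf_algebra (conc_hopf k A).
Proof.
split.
- exact: malg_mulPl.
- exact: malg_mulPr.
- exact: mulrA.
- exact: mul1r.
- exact: mulr1.
- exact: deltaP.
- exact: counit_scalar.
- exact: delta_coassoc.
- exact: delta_counitl.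
- exact: delta_counitr.
- exact: deltaM.
- exact: delta1.
- exact: counitM.
- exact: counit1.
- by exists conc_antipode; exact: conc_antipode_is_antipode.
Qed.

End Concatenation.

(** Bookkeeping for the two expansions of a triple product. The name of each vector records which
    letter or bracket is split off in front; the four scalar hypotheses compare powers of [q]. *)
Lemma regroup_terms (k : fieldType) (V : lmodType k)
    (vA1 vA2 vA3 vB vC1 vC2 vC3 vAB vAC vBC vABC : V)
    (x p r s y1 y2 t1 t2 z3 z4 z5 z6 : k) :
  x = t1 * z3 -> p = t1 * z4 -> y1 * r = t2 * z5 -> y2 * s = t2 * z6 ->
  (vA1 + t1 *: vA2 + t2 *: vA3 + x *: vC1 + p *: vAC)
  + y1 *: (vB + x *: vC2 + r *: vBC)
  + y2 *: (vAB + x *: vC3 + s *: vABC)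
  = (vA1 + y1 *: vB + y2 *: vAB)
  + t1 *: (vA2 + z3 *: (vC1 + y1 *: vC2 + y2 *: vC3) + z4 *: vAC)
  + t2 *: (vA3 + z5 *: vBC + z6 *: vABC).
Proof.
move=> ex ep er es; rewrite !scalerDr !scalerA er es ex ep.
rewrite !(mulrC y1) !(mulrC y2) !addrA.
(* The permutation lists the eleven summands of the left side in the order in which the right side
   has them. *)
by rewrite [LHS](ACl (1*6*9*2*4*7*10*5*3*8*11)).
Qed.

(* Inductive step for the associativity of [*_q] on [a u], [b v], [c w]:
   [la] is left concatenation with [a], [lab] with [[a, b]], and so on. *)
Lemma qprod_assoc_step (k : fieldType) (V : lmodType k) (m : V -> V -> V)
    (la lb lc lab lac lbc labc : V -> V) (u v w : V)
    (x p r s y1 y2 t1 t2 z3 z4 z5 z6 : k) :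
  (forall y, linear (m^~ y)) -> (forall y, linear (m y)) ->
  linear la -> linear lc ->
  m (la u) (lb v)
  = la (m u (lb v)) + y1 *: lb (m (la u) v) + y2 *: lab (m u v) ->
  m (lb v) (lc w)
  = lb (m v (lc w)) + t1 *: lc (m (lb v) w) + t2 *: lbc (m v w) ->
  (forall z, z = m u (lb v) ->
     m (la z) (lc w)
     = la (m z (lc w)) + x *: lc (m (la z) w) + p *: lac (m z w)) ->
  (forall z, z = m (la u) v ->
     m (lb z) (lc w)
     = lb (m z (lc w)) + x *: lc (m (lb z) w) + r *: lbc (m z w)) ->
  (forall z, z = m u v ->
     m (lab z) (lc w)
     = lab (m z (lc w)) + x *: lc (m (lab z) w) + s *: labc (m z w)) ->
  (forall y, m (la u) (lb y)
     = la (m u (lb y)) + y1 *: lb (m (la u) y) + y2 *: lab (m u y)) ->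
  (forall y, m (la u) (lc y)
     = la (m u (lc y)) + z3 *: lc (m (la u) y) + z4 *: lac (m u y)) ->
  (forall y, m (la u) (lbc y)
     = la (m u (lbc y)) + z5 *: lbc (m (la u) y) + z6 *: labc (m u y)) ->
  (forall v' w', m (m u v') w' = m u (m v' w')) ->
  (forall w', m (m (la u) v) w' = m (la u) (m v w')) ->
  m (m (la u) (lb v)) w = m (la u) (m (lb v) w) ->
  [/\ x = t1 * z3, p = t1 * z4, y1 * r = t2 * z5 & y2 * s = t2 * z6] ->
  m (m (la u) (lb v)) (lc w) = m (la u) (m (lb v) (lc w)).
Proof.
move=> ml mr lla llc E1 E2 rA rB rAB eB eC eBC IHu IHv IHw [ex ep er es].
have mlD y := linear_funD (ml y); have mlZ y := linear_funZ (ml y).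
have mrD y := linear_funD (mr y); have mrZ y := linear_funZ (mr y).
(* Two terms need a second expansion: the one starting with [c] on the right, by the hypothesis for
   [w] and [E1], and the one starting with [a] on the left, by [E2] once the hypothesis for [u] has
   rebracketed it. *)
have EC : lc (m (la u) (m (lb v) w)) = lc (m (la (m u (lb v))) w)
    + y1 *: lc (m (lb (m (la u) v)) w) + y2 *: lc (m (lab (m u v)) w).
  by rewrite -IHw E1 !(mlD, mlZ) !(linear_funD llc, linear_funZ llc).
have EA : la (m u (m (lb v) (lc w))) = la (m u (lb (m v (lc w))))
    + t1 *: la (m u (lc (m (lb v) w))) + t2 *: la (m u (lbc (m v w))).
  by rewrite E2 !(mrD, mrZ) !(linear_funD lla, linear_funZ lla).
rewrite [in LHS]E1 [in RHS]E2 !(mlD, mlZ) !(mrD, mrZ).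
rewrite (rA _ erefl) (rB _ erefl) (rAB _ erefl) eB eC eBC.
by rewrite !IHu !IHv EA EC (regroup_terms _ _ _ _ _ _ _ _ _ _ _ ex ep er es).
Qed.

(** * The product [*_q]: recursion, homogeneity, associativity *)

Section QuasiShuffleProduct.
Variables (k : fieldType) (A : choiceType) (deg : A -> nat).
Variable br : option A -> option A -> option A.
Variable q : k.
Hypothesis S0 : forall a, br a None = None.
Hypothesis S1 : forall a b, br a b = br b a.
Hypothesis S2 : forall a b c, br (br a b) c = br a (br b c).
Hypothesis S3 : forall a b : A, br (Some a) (Some b) = None \/
  exists c : A, br (Some a) (Some b) = Some c /\ deg c = (deg a + deg b)%N.
Local Notation W := {fmonom A}.
Local Notation NC := {malg k[{fmonom A}]}.
Local Notation NC2 := {malg k[(W * W)%type]}.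
Local Notation word := (@word k A).
Local Notation letter := (@letter k A).
Local Notation letter0 := (@letter0 k A).
Local Notation wdeg := (wdeg deg).
Local Notation qprod := (qprod deg br q).
Local Notation Phi := (Phi deg br q).
Implicit Types (a b c : A) (s t u v w : seq A) (x y z : NC).

Lemma qprodPl y : linear (qprod^~ y).
Proof. exact: bilin_extPl. Qed.

Lemma qprodPr x : linear (qprod x).
Proof. exact: bilin_extPr. Qed.

Lemma qprod_words u v : qprod (word u) (word v) = qprod_word deg br q u v.
Proof. exact: bilin_extU. Qed.

Lemma qprod1x x : qprod 1 x = x.
Proof.
move: x; apply: word_ext => [||s]; [exact: qprodPr | exact: linear_id |].
by rewrite -word_nil qprod_words; case: s.
Qed.

Lemma qprodx1 x : qprod x 1 = x.
Proof.
move: x; apply: word_ext => [||s]; [exact: qprodPl | exact: linear_id |].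
by rewrite -word_nil qprod_words; case: s.
Qed.

Lemma wdeg_cons a s : wdeg (a :: s) = (deg a + wdeg s)%N.
Proof. exact: big_cons. Qed.

Lemma scaler_linear (V : lmodType k) (e : k) : linear (fun x : V => e *: x).
Proof. by move=> c u v; rewrite scalerDr !scalerA mulrC. Qed.

(** The exponents involve the right factor only through [b], so the recursion extends linearly to
    any [y]. The left factor stays a word since its degree occurs. *)
Lemma qprod_recr a u b y :
  qprod (word (a :: u)) (letter b * y) =
    letter a * qprod (word u) (letter b * y)
    + q ^+ (wdeg (a :: u) * deg b) *: (letter b * qprod (word (a :: u)) y)
    + q ^+ (wdeg u * deg b) *:
        (letter0 (br (Some a) (Some b)) * qprod (word u) y).
Proof.
have mr := @malg_mulPr k W; have lq := qprodPr.
move: y; apply: word_ext => [||v].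
- exact: linear_comp (lq _) (mr _).
- apply: linear_add_fun; first apply: linear_add_fun.
  + exact: linear_comp (mr _) (linear_comp (lq _) (mr _)).
  + exact: linear_comp (@scaler_linear _ _) (linear_comp (mr _) (lq _)).
  + exact: linear_comp (@scaler_linear _ _) (linear_comp (mr _) (lq _)).
rewrite <- !word_cons; by rewrite -> !qprod_words.
Qed.

(** Zero is homogeneous of every degree, which accommodates vanishing brackets. *)
Definition homog (d : nat) x := forall s, x@_(FMonom s) != 0 -> wdeg s = d.

Lemma homog_word s : homog (wdeg s) (word s).
Proof.
by move=> u; rewrite word_coef; case: (s =P u) => [->|_] //; rewrite eqxx.
Qed.

Lemma homogD d x y : homog d x -> homog d y -> homog d (x + y).
Proof.
move=> hx hy s; rewrite mcoeffD => nz.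
have [x0|/hx //] := eqVneq x@_(FMonom s) 0.
by apply: hy; rewrite x0 add0r in nz.
Qed.

Lemma homogZ d (e : k) x : homog d x -> homog d (e *: x).
Proof.
by move=> hx s; rewrite mcoeffZ mulf_eq0 negb_or => /andP [_ /hx].
Qed.

Lemma homog_letter_mul a d x : homog d x -> homog (deg a + d) (letter a * x).
Proof.
move=> hx [|b s]; rewrite letter_mul_coef ?eqxx //.
rewrite mulf_eq0 negb_or; case: (a =P b) => [->|_]; last by rewrite eqxx.
by case/andP=> _ /hx; rewrite wdeg_cons => ->.
Qed.

Lemma homog_br_mul a b d x : homog d x ->
  homog (deg a + deg b + d) (letter0 (br (Some a) (Some b)) * x).
Proof.
move=> hx; case: (S3 a b) => [->|[c [-> <-]]]; last exact: homog_letter_mul.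
by move=> s; rewrite mul0r mcoeff0 eqxx.
Qed.

Lemma homog_qprod u v : homog (wdeg u + wdeg v) (qprod (word u) (word v)).
Proof.
elim: u v => [|a u IHu] v.
  by rewrite word_nil qprod1x {1}/Defs.wdeg big_nil; exact: homog_word.
elim: v => [|b v IHv].
  by rewrite word_nil qprodx1 [X in (_ + X)%N]big_nil addn0; exact: homog_word.
rewrite (word_cons k b) qprod_recr.
rewrite (wdeg_cons a u) (wdeg_cons b v); apply: homogD; first apply: homogD.
- have := homog_letter_mul (a := a) (IHu (b :: v)).
  by rewrite wdeg_cons (word_cons k b) addnA.
- have := homog_letter_mul (a := b) IHv.
  by rewrite wdeg_cons addnCA; exact: homogZ.
- by have := homog_br_mul (a := a) (b := b) (IHu v); rewrite addnACA;
    exact: homogZ.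
Qed.

Lemma homog_ext (U : lmodType k) d (F G : NC -> U) :
  linear F -> linear G -> (forall s, wdeg s = d -> F (word s) = G (word s)) ->
  forall x, homog d x -> F x = G x.
Proof.
move=> lF lG FG x hx; rewrite [x]malg_sum !linear_fun_sum //.
apply: eq_big_seq => -[s] xs; rewrite !linear_funZ //; congr (_ *: _).
by apply: FG; apply: hx; rewrite mcoeff_neq0.
Qed.

(** With a polynomial on the left the exponents are constant only if all its words have the same
    degree [d]. *)
Lemma qprod_recl a c d x y : homog d x ->
  qprod (letter a * x) (letter c * y) =
    letter a * qprod x (letter c * y)
    + q ^+ ((deg a + d) * deg c) *: (letter c * qprod (letter a * x) y)
    + q ^+ (d * deg c) *: (letter0 (br (Some a) (Some c)) * qprod x y).
Proof.
have ml := @malg_mulPl k W; have mr := @malg_mulPr k W; have lq := qprodPl.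
move: x; apply: homog_ext => [||s <-].
- exact: linear_comp (lq _) (mr _).
- apply: linear_add_fun; first apply: linear_add_fun.
  + exact: linear_comp (mr _) (lq _).
  + apply: (linear_comp (@scaler_linear _ _)).
    exact: linear_comp (mr _) (linear_comp (lq _) (mr _)).
  + exact: linear_comp (@scaler_linear _ _) (linear_comp (mr _) (lq _)).
by rewrite <- word_cons; rewrite -> qprod_recr, wdeg_cons.
Qed.

Lemma letter0_None_mul x : letter0 None * x = 0.
Proof. exact: mul0r. Qed.

Lemma letter_mul0 a : letter a * 0 = 0.
Proof. exact: mulr0. Qed.

Lemma qprod0x y : qprod 0 y = 0.
Proof. exact: linear_fun0 (qprodPl y). Qed.

Lemma qprodx0 x : qprod x 0 = 0.
Proof. exact: linear_fun0 (qprodPr x). Qed.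

(** By (S3) a bracket acts as a letter of degree |a| + |b|, or is zero and every term vanishes. *)
Lemma qprod_br_recl a b c d x y : homog d x ->
  let ab := br (Some a) (Some b) in
  qprod (letter0 ab * x) (letter c * y) =
    letter0 ab * qprod x (letter c * y)
    + q ^+ ((deg a + deg b + d) * deg c) *:
        (letter c * qprod (letter0 ab * x) y)
    + q ^+ (d * deg c) *: (letter0 (br ab (Some c)) * qprod x y).
Proof.
move=> hx ab; rewrite /ab; case: (S3 a b) => [->|[e [-> <-]]].
  have -> : br None (Some c) = None by rewrite S1 S0.
  rewrite -> !letter0_None_mul, !qprod0x, letter_mul0.
  by rewrite !scaler0 !addr0.
exact: qprod_recl.
Qed.

Lemma qprod_br_recr a u b c y :
  let bc := br (Some b) (Some c) in
  qprod (word (a :: u)) (letter0 bc * y) =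
    letter a * qprod (word u) (letter0 bc * y)
    + q ^+ (wdeg (a :: u) * (deg b + deg c)) *:
        (letter0 bc * qprod (word (a :: u)) y)
    + q ^+ (wdeg u * (deg b + deg c)) *:
        (letter0 (br (Some a) bc) * qprod (word u) y).
Proof.
move=> bc; rewrite /bc; case: (S3 b c) => [->|[e [-> <-]]].
  rewrite -> S0, !letter0_None_mul, !qprodx0, letter_mul0.
  by rewrite !scaler0 !addr0.
exact: qprod_recr.
Qed.

Lemma qprod_assoc_extr x y :
  (forall w, qprod (qprod x y) (word w) = qprod x (qprod y (word w))) ->
  forall z, qprod (qprod x y) z = qprod x (qprod y z).
Proof.
move=> H; apply: word_ext => // [|]; first exact: qprodPr.
exact: linear_comp (qprodPr x) (qprodPr y).
Qed.

Lemma qprodA_words u v w :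
  qprod (qprod (word u) (word v)) (word w)
  = qprod (word u) (qprod (word v) (word w)).
Proof.
have mr := @malg_mulPr k W; have lql := qprodPl; have lqr := qprodPr.
(* Nested induction: [IHu] holds for all [v] and [w], [IHv] for the fixed [a :: u] and all [w],
   [IHw] with both left words fixed. *)
elim: u v w => [|a u IHu] v w; first by rewrite word_nil !qprod1x.
elim: v w => [|b v IHv] w; first by rewrite word_nil qprodx1 qprod1x.
elim: w => [|c w IHw]; first by rewrite word_nil !qprodx1.
rewrite (word_cons k a u) (word_cons k b v) (word_cons k c w).
have hr := homog_qprod.
(* The scalar [x] is the cost of moving [c] past the whole product of the first two words. It is
   shared by three recursions because a(u *_q bv), b(au *_q v) and [a,b](u *_q v) have the same
   degree. *)
apply: (qprod_assoc_step (m := qprod) (la := *%R (letter a))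
  (lb := *%R (letter b)) (lc := *%R (letter c))
  (lab := *%R (letter0 (br (Some a) (Some b))))
  (lac := *%R (letter0 (br (Some a) (Some c))))
  (lbc := *%R (letter0 (br (Some b) (Some c))))
  (labc := *%R (letter0 (br (Some a) (br (Some b) (Some c)))))
  (x := q ^+ ((wdeg (a :: u) + wdeg (b :: v)) * deg c))
  lql lqr (mr _) (mr _)).
- by rewrite -(word_cons k a u); exact: qprod_recr.
- by rewrite -(word_cons k b v); exact: qprod_recr.
- move=> z zE; rewrite !wdeg_cons -addnA -wdeg_cons.
  by apply: qprod_recl; rewrite zE -(word_cons k b v).
- move=> z zE; rewrite [in q ^+ _]addnC !wdeg_cons -addnA [(wdeg v + _)%N]addnC.
  rewrite -wdeg_cons.
  by apply: qprod_recl; rewrite zE -(word_cons k a u).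
(* (S2) makes the triple bracket the same in both expansions. *)
- move=> z zE; rewrite !wdeg_cons addnACA -S2.
  by apply: qprod_br_recl; rewrite zE.
- by rewrite -(word_cons k a u) => y; exact: qprod_recr.
- by rewrite -(word_cons k a u) => y; exact: qprod_recr.
- by rewrite -(word_cons k a u) => y; exact: qprod_br_recr.
- move=> y z; move: y; apply: word_ext => [||v'].
  + exact: linear_comp (lql z) (lqr (word u)).
  + exact: linear_comp (lqr (word u)) (lql z).
  + exact: qprod_assoc_extr (IHu v') z.
- by rewrite -(word_cons k a u); exact: qprod_assoc_extr.
- by rewrite -(word_cons k a u) -(word_cons k b v).
(* Only exponents are compared, so [q = 0] needs no separate case; the first identity is (|au| +
   |bv|)|c| = |bv||c| + |au||c|. *)
- by rewrite -!exprD; split; congr (_ ^+ _); rewrite ?wdeg_cons; ring.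
Qed.

Lemma qprodA : associative qprod.
Proof.
have lql := qprodPl; have lqr := qprodPr.
move=> x y z; move: x; apply: word_ext => [||u].
- exact: lql.
- exact: linear_comp (lql z) (lql y).
move: y; apply: word_ext => [||v].
- exact: linear_comp (lqr (word u)) (lql z).
- exact: linear_comp (lql z) (lqr (word u)).
by apply: esym; apply: qprod_assoc_extr => w; exact: qprodA_words.
Qed.

(** * The homomorphism [Phi], the counit and [Delta] *)

Lemma PhiP : linear Phi.
Proof. exact: lin_ext_is_linear. Qed.

Lemma Phi1 : Phi 1 = 1.
Proof. by rewrite -{1}word_nil /Defs.Phi lin_extU. Qed.

Lemma Phi_letter_mul a x : Phi (letter a * x) = qprod (letter a) (Phi x).
Proof.
move: x; apply: word_ext => [||s].
- exact: linear_comp PhiP (malg_mulPr (letter a)).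
- exact: linear_comp (qprodPr (letter a)) PhiP.
by rewrite -word_cons /Defs.Phi !lin_extU.
Qed.

Lemma Phi_letter a : Phi (letter a) = letter a.
Proof. by rewrite -{1}[letter a]mulr1 Phi_letter_mul Phi1 qprodx1. Qed.

Lemma PhiM x y : Phi (x * y) = qprod (Phi x) (Phi y).
Proof.
move: x; apply: word_ext => [||s].
- exact: linear_comp PhiP (malg_mulPl y).
- exact: linear_comp (qprodPl (Phi y)) PhiP.
elim: s => [|a s IH]; first by rewrite word_nil mul1r Phi1 qprod1x.
rewrite word_cons -mulrA; rewrite -> !Phi_letter_mul.
by rewrite -> IH; exact: qprodA.
Qed.

(** Every term of the recursion starts with a letter or with a bracket that is a letter or zero, so
    there is no constant term. *)
Lemma counit_letter_qprod a x : counit (qprod (letter a) x) = 0.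
Proof.
move: x; apply: (word_ext (U := k^o)) => [||[|b s]].
- exact: linear_comp (@counit_scalar k A) (qprodPr (letter a)).
- by move=> c x y; rewrite scaler0 addr0.
- by rewrite word_nil qprodx1 -[letter a]mulr1 counit_letter_mul.
have CD (x y : NC) : counit (x + y) = counit x + counit y := mcoeffD _ x y.
have CZ (e : k) (y : NC) : counit (e *: y) = e * counit y := mcoeffZ e y _.
rewrite word_cons qprod_recr; rewrite -> !CD, !CZ, !counit_letter_mul.
rewrite mulr0 !add0r.
case: (br _ _) => [d|]; first by rewrite (counit_letter_mul d) mulr0.
by rewrite letter0_None_mul /Defs.counit mcoeff0 mulr0.
Qed.

Lemma counit_Phi x : counit (Phi x) = counit x.
Proof.
move: x; apply: (word_ext (U := k^o)) => [||[|a s]].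
- exact: linear_comp (@counit_scalar k A) PhiP.
- exact: counit_scalar.
- by rewrite word_nil Phi1.
- by rewrite word_cons Phi_letter_mul counit_letter_qprod counit_letter_mul.
Qed.

Lemma is_Delta_unique D D' :
  generic deg br q -> is_Delta deg br q D -> is_Delta deg br q D' -> D =1 D'.
Proof.
case=> Psi PhiK PsiK [lD D1 Dl DM] [lD' D'1 D'l D'M] x.
(* Surjectivity of [Phi] turns [x] into a combination of [*_q]-products of letters, on which the
   defining conditions fix the value. *)
rewrite -(PsiK x); move: (Psi x); apply: word_ext => [||s].
- exact: linear_comp lD PhiP.
- exact: linear_comp lD' PhiP.
elim: s => [|a s IH]; first by rewrite word_nil Phi1 D1 D'1.
by rewrite word_cons Phi_letter_mul DM D'M Dl D'l IH.
Qed.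

Lemma Delta_Phi x : generic deg br q ->
  Delta deg br q (Phi x) = tens_map Phi Phi (@delta k A x).
Proof.
move=> gen; have [Psi PhiK PsiK] := gen.
have lPsi : linear Psi := linear_can PhiP PhiK PsiK.
have lPhi := PhiP.
pose D y := tens_map Phi Phi (@delta k A (Psi y)).
have hD : is_Delta deg br q D.
  split.
  - exact: linear_comp (tens_mapP _ _) (linear_comp (@deltaP k A) lPsi).
  - by rewrite /D -{1}Phi1 PhiK delta1 (tens_mapE _ _ lPhi lPhi) Phi1.
  - move=> a; rewrite /D -{1}[letter a]Phi_letter PhiK delta_letter.
    rewrite (linear_funD (tens_mapP _ _)).
    by rewrite -> !(tens_mapE _ _ lPhi lPhi), !Phi1, !Phi_letter.
  - move=> u v; rewrite /D -{1}(PsiK u) -{1}(PsiK v) -PhiM PhiK deltaM.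
    exact: (tens_map_mul _ _ (@malg_mulPl k W) (@malg_mulPr k W)
              qprodPl qprodPr lPhi PhiM).
(* The witness [D] rules out the default value of [xget]; uniqueness then identifies the chosen map
   with [D]. *)
have hDelta : is_Delta deg br q (Delta deg br q).
  by apply: xgetPex; exists D.
by rewrite (is_Delta_unique gen hDelta hD) /D PhiK.
Qed.

End QuasiShuffleProduct.

Theorem theorem5p5 (R : realType) (k : fieldType) (emb : {rmorphism k -> R[i]})
  (A : choiceType) (deg : A -> nat)
  (deg_ge1 : forall a : A, (1 <= deg a)%N)
  (deg_finite : forall n : nat, finite_set [set a : A | deg a = n])
  (br : option A -> option A -> option A)
  (S0 : forall a : option A, br a None = None)
  (S1 : forall a b : option A, br a b = br b a)
  (S2 : forall a b c : option A, br (br a b) c = br a (br b c))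
  (S3 : forall a b : A, br (Some a) (Some b) = None \/
     exists c : A, br (Some a) (Some b) = Some c /\ deg c = (deg a + deg b)%N)
  (q : k) (q_generic : generic deg br q) :
  is_hopf_isomorphism (conc_hopf k A) (qprod_hopf deg br q) (Phi deg br q).
Proof.
have [Psi PhiK PsiK] := q_generic.
apply: (transport_hopf_isomorphism (g := Psi)).
- exact: conc_is_hopf_algebra.
- exact: PhiP.
- exact: PhiK.
- exact: PsiK.
- exact: PhiM S0 S1 S2 S3.
- exact: Phi1.
- by move=> x; exact: Delta_Phi S0 S1 S2 S3 _ q_generic.
- exact: counit_Phi.
Qed.
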